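(* Let $w(z)=\sum_{n=1}^\infty w_nz^n$ be an analytic self map of $\mathbb{D}$ (so $w(0)=0$ and $w(\mathbb{D})\subseteq\mathbb{D}$). Then $\mathcal{M}_{w'}(r)\leq 1$ for all $r=|z|\leq r_0:=1-\sqrt{2/3}$. This radius $r_0$ is the best possible, i.e. it cannot be replaced by any larger number: for every $r\in(r_0,1)$ there is an analytic self map $w$ of $\mathbb{D}$ with $w(0)=0$ and $\mathcal{M}_{w'}(r)>1$.
   Context: $\mathbb{D}$ denotes the open unit disk in $\mathbb{C}$. For a complex valued analytic function $F(z)=\sum_{n=0}^\infty A_nz^n$ in $\mathbb{D}$, its majorant series is $\mathcal{M}_F(r):=\sum_{n=0}^\infty |A_n|r^n$ for $0\le r<1$. Here $w'$ is the derivative of $w$. *)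

(* Defs.v *)
From Stdlib Require Export Reals.
From Stdlib Require Import ClassicalEpsilon.
From Coquelicot Require Export Coquelicot.
Open Scope R_scope.

Definition in_disk (z : C) : Prop := Cmod z < 1.

Definition has_expansion (F : C -> C) (A : nat -> C) : Prop :=
  forall z : C, in_disk z ->
    is_pseries (K := C_AbsRing) (V := C_NormedModule) A z (F z).

(* F may take arbitrary values outside the disk. *)
Definition analytic_in_disk (F : C -> C) : Prop :=
  exists A : nat -> C, has_expansion F A.

(* For F analytic in the disk these are its Taylor coefficients at 0, since
   the sequence A with has_expansion F A is then unique; otherwise they are
   unspecified. *)
Definition coeffs (F : C -> C) : nat -> C :=
  epsilon (inhabits (fun _ : nat => RtoC 0)) (has_expansion F).

(* For 0 <= r the partial sums are nondecreasing, so this limit is the sum of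
   the majorant series, p_infty when it diverges. *)
Definition majorant (F : C -> C) (r : R) : Rbar :=
  Lim_seq (fun N : nat => sum_n (fun n : nat => Cmod (coeffs F n) * r ^ n) N).

Definition analytic_self_map (w : C -> C) : Prop :=
  analytic_in_disk w /\ forall z : C, in_disk z -> in_disk (w z).

Definition r0 : R := 1 - sqrt (2 / 3).

(* Main.v *)
Require Import Defs.
From Stdlib Require Import Lra Lia ZArith ClassicalEpsilon Classical.

(** Write [w = sum w_n z^n] with [w_0 = 0], and put [a = |w_1|].  Everything
    rests on the coefficient inequality [|w_n| <= 1 - a^2] for [n >= 2]
    ([schwarz_pick_coeff]), usually obtained from the Schwarz lemma and the
    Schwarz-Pick inequality for [w(z)/z].  Here it comes from a single mean
    value.  For [k >= 1] and any complex [q], the coefficient of [z^(k+1)] in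
    [(1 + q z^k)^2 w(z)] is [w_(k+1) + 2 q w_1], because [w_0 = 0]; since
    [|w| <= 1], it is at most the mean of [|1 + q z^k|^2] over the unit circle,
    which is [1 + |q|^2].  Taking [|q| = a] with the phase that aligns the two
    terms gives [|w_(k+1)| + 2 a^2 <= 1 + a^2].  The argument is run on circles
    of radius [s < 1], and [s] then tends to 1.  The means are averages over
    roots of unity, exact on trigonometric polynomials of small degree, so the
    series of [w] is first truncated, uniformly on the circle
    ([trig_two_coeff_bound], [trig_eventually_bounded]).  The same averages give
    the Cauchy estimate, hence uniqueness of the coefficients, which identifies
    the sequence that [coeffs] selects.

    The complex derivative is computed term by term ([derive_expansion]), so the
    majorant of [w'] at [r] is [sum (n+1) |w_(n+1)| r^n].  With
    [T = sum (n+1) r^n = 1 / (1 - r)^2] it is at most [a + (1 - a^2) (T - 1)],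
    and [r <= r0] means exactly [T <= 3/2]; then the bound is at most
    [a + (1 - a^2) / 2 = 1 - (1 - a)^2 / 2 <= 1].

    For sharpness take [w(z) = z (a - z) / (1 - a z)] with [0 < a < 1], for which
    [|w_(n+2)| = (1 - a^2) a^n].  The majorant of [w'] at [r] exceeds 1 as soon
    as [(1 + a) a^N (T_N - 1) > 1] for some partial sum [T_N] of [T].  At [a = 1]
    this reads [T_N > 3/2], which holds for large [N] when [r > r0]; for such an
    [N] the inequality persists for [a < 1] close to 1
    ([extremal_parameter]). *)

(** * Finite sums and complex arithmetic *)

(** Sums of complex numbers are typed in the carrier of an abelian monoid, which
    [ring] does not recognise as the complex field. *)
Ltac Cring := match goal with |- @eq _ ?a ?b => change (@eq C a b) end; ring.

Lemma sum_Sn_C (u : nat -> C) (N : nat) :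
  sum_n u (S N) = (sum_n u N + u (S N))%C.
Proof. exact (sum_Sn (G := C_AbelianMonoid) u N). Qed.

Lemma sum_n_Cplus (u v : nat -> C) (N : nat) :
  sum_n (fun n => (u n + v n)%C) N = (sum_n u N + sum_n v N)%C.
Proof. exact (sum_n_plus (G := C_AbelianMonoid) u v N). Qed.

Lemma sum_n_Cmult_l (c : C) (u : nat -> C) (N : nat) :
  sum_n (fun n => (c * u n)%C) N = (c * sum_n u N)%C.
Proof. exact (sum_n_mult_l (K := C_Ring) c u N). Qed.

Lemma sum_Sn_R (u : nat -> R) (N : nat) : sum_n u (S N) = sum_n u N + u (S N).
Proof. exact (sum_Sn (G := R_AbelianMonoid) u N). Qed.

Lemma Cmod_sum_n (u : nat -> C) (N : nat) :
  Cmod (sum_n u N) <= sum_n (fun n => Cmod (u n)) N.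
Proof.
  induction N as [|N IH]; [rewrite !sum_O; lra|].
  rewrite !sum_Sn.
  apply Rle_trans with (1 := Cmod_triangle _ _).
  apply Rplus_le_compat_r, IH.
Qed.

Lemma sum_n_le_R (u v : nat -> R) (N : nat) :
  (forall n, (n <= N)%nat -> u n <= v n) -> sum_n u N <= sum_n v N.
Proof. intros H. rewrite !sum_n_Reals. apply sum_Rle. exact H. Qed.

Lemma partial_sum_le_Series (u : nat -> R) (N : nat) :
  (forall n, 0 <= u n) -> ex_series u -> sum_n u N <= Series u.
Proof.
  intros Hu Hs. rewrite sum_n_Reals.
  apply sum_incr; [|exact Hu].
  apply is_lim_seq_Reals.
  apply is_lim_seq_ext with (sum_n u); [intros; apply sum_n_Reals|].
  apply Series_correct, Hs.
Qed.

Lemma RtoC_pow (s : R) (n : nat) : RtoC (s ^ n) = (RtoC s ^ n)%C.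
Proof.
  induction n as [|n IH]; [reflexivity|].
  rewrite Cpow_S, <- IH, <- RtoC_mult. reflexivity.
Qed.

Lemma Cconj_mult_self (y : C) : (Cconj y * y)%C = RtoC (Cmod y ^ 2).
Proof.
  unfold Cmod. rewrite pow2_sqrt by nra.
  unfold Cmult, Cconj, RtoC; simpl. f_equal; ring.
Qed.

(** * Power series on the unit disk *)

Definition psum (A : nat -> C) (z : C) (N : nat) : C :=
  sum_n (fun n => (A n * z ^ n)%C) N.

Lemma is_series_C_eps (a : nat -> C) (l : C) :
  is_series (K := C_AbsRing) (V := C_NormedModule) a l <->
  forall eps : R, 0 < eps -> exists N0, forall N, (N0 <= N)%nat ->
    Cmod (sum_n a N - l) < eps.
Proof.
  unfold is_series.
  rewrite (filterlim_locally_ball_norm (K := C_AbsRing) (U := C_NormedModule)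
             (sum_n a) l).
  unfold eventually, ball_norm.
  split.
  - intros H eps He. destruct (H (mkposreal eps He)) as [N0 HN].
    exists N0. intros N HN'. specialize (HN N HN').
    exact HN.
  - intros H eps. destruct (H eps (cond_pos eps)) as [N0 HN].
    exists N0. intros N HN'. exact (HN N HN').
Qed.

Lemma pow_n_Cpow (z : C) (n : nat) : pow_n (K := C_Ring) z n = (z ^ n)%C.
Proof.
  induction n as [|n IH]; [reflexivity|].
  rewrite Cpow_S, <- IH. reflexivity.
Qed.

Lemma psum_scal (A : nat -> C) (z : C) (N : nat) :
  sum_n (fun k : nat => scal (K := C_Ring) (V := C_NormedModule)
                          (pow_n (K := C_Ring) z k) (A k)) N = psum A z N.
Proof.
  apply sum_n_ext. intros n. rewrite pow_n_Cpow.
  change (z ^ n * A n = A n * z ^ n)%C. ring.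
Qed.

(** Convergence in terms of [Cmod] and [Cpow], free of the generic module
    operations; all later estimates on partial sums use this form. *)
Lemma is_pseries_C_eps (A : nat -> C) (z l : C) :
  is_pseries (K := C_AbsRing) (V := C_NormedModule) A z l <->
  forall eps : R, 0 < eps -> exists N0, forall N, (N0 <= N)%nat ->
    Cmod (psum A z N - l) < eps.
Proof.
  unfold is_pseries. rewrite is_series_C_eps.
  split; intros H eps He; destruct (H eps He) as [N0 HN]; exists N0; intros N HN';
    specialize (HN N HN').
  - rewrite psum_scal in HN. exact HN.
  - rewrite psum_scal. exact HN.
Qed.

(** A closed bound passes to the limit: it may be checked on points arbitrarily
    close to [x], such as partial sums of a series with sum [x]. *)
Lemma Cmod_eps_le (x y : C) (M : R) :
  (forall eps, 0 < eps -> exists x', Cmod (x' - x) < eps /\ Cmod (x' - y) <= M) ->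
  Cmod (x - y) <= M.
Proof.
  intros H. apply le_epsilon. intros eps He.
  destruct (H eps He) as [x' [H1 H2]].
  replace (x - y)%C with (- (x' - x) + (x' - y))%C by ring.
  apply Rle_trans with (1 := Cmod_triangle _ _). rewrite Cmod_opp. lra.
Qed.

(** The terms of a series convergent at a real [x] with [s < x < 1] are bounded.
    This brings in the theory of real power series for the series of moduli, in
    particular that differentiating keeps the radius of convergence. *)
Lemma CV_radius_ge_1 (F : C -> C) (A : nat -> C) (s : R) :
  has_expansion F A -> 0 <= s < 1 ->
  Rbar_lt s (CV_radius (fun n => Cmod (A n))).
Proof.
  intros HF Hs.
  set (x := (s + 1) / 2). assert (Hx : s < x < 1) by (unfold x; lra).
  apply Rbar_lt_le_trans with x; [simpl; lra|].
  destruct (CV_radius_bounded (fun n => Cmod (A n))) as [Hub _].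
  apply Hub.
  assert (Hd : in_disk (RtoC x)).
  { unfold in_disk. rewrite Cmod_R, Rabs_pos_eq; lra. }
  set (t := fun n => (A n * RtoC x ^ n)%C).
  assert (Hb : exists M, forall n, Cmod (sum_n t n) <= M).
  { destruct (filterlim_bounded (K := C_AbsRing) (V := C_NormedModule) _
                (ex_intro _ _ (HF _ Hd))) as [M HM].
    exists M. intros n. specialize (HM n). rewrite psum_scal in HM. exact HM. }
  destruct Hb as [M HM].
  exists (M + M). intros n.
  assert (HtR : Rabs (Cmod (A n) * x ^ n) = Cmod (t n)).
  { unfold t. rewrite Cmod_mult, Cmod_pow, Cmod_R, (Rabs_pos_eq x) by lra.
    apply Rabs_pos_eq. apply Rmult_le_pos; [apply Cmod_ge_0|apply pow_le; lra]. }
  rewrite HtR. pose proof (Rle_trans _ _ _ (Cmod_ge_0 _) (HM 0%nat)) as HM0.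
  destruct n as [|n].
  - specialize (HM 0%nat). rewrite sum_O in HM. lra.
  - replace (t (S n)) with (sum_n t (S n) - sum_n t n)%C
      by (rewrite sum_Sn; change (sum_n t n + t (S n) - sum_n t n = t (S n))%C; ring).
    apply Rle_trans with (1 := Cmod_triangle _ _).
    rewrite Cmod_opp. apply Rplus_le_compat; apply HM.
Qed.

Lemma abs_summable (F : C -> C) (A : nat -> C) (s : R) :
  has_expansion F A -> 0 <= s < 1 ->
  ex_series (fun n => Cmod (A n) * s ^ n).
Proof.
  intros HF Hs.
  apply ex_series_ext with (fun n => Rabs (Cmod (A n) * s ^ n)).
  - intros n. apply Rabs_pos_eq. apply Rmult_le_pos; [apply Cmod_ge_0|apply pow_le; lra].
  - apply (CV_disk_inside (fun n => Cmod (A n))). rewrite Rabs_pos_eq by lra.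
    apply CV_radius_ge_1 with F; assumption.
Qed.

(** The tail at [z] is dominated by the tail at [s] of the series of moduli,
    which does not depend on [z]. *)
Lemma uniform_tail (F : C -> C) (A : nat -> C) (s : R) :
  has_expansion F A -> 0 <= s < 1 ->
  forall eps, 0 < eps -> exists N0, forall N, (N0 <= N)%nat ->
    forall z, Cmod z <= s -> Cmod (F z - psum A z N) <= eps.
Proof.
  intros HF Hs eps He.
  set (u := fun n => Cmod (A n) * s ^ n).
  assert (Hu : forall n, 0 <= u n)
    by (intros n; apply Rmult_le_pos; [apply Cmod_ge_0|apply pow_le; lra]).
  assert (Hex : ex_series u) by (apply abs_summable with F; assumption).
  assert (Hlim : is_lim_seq (sum_n u) (Series u)) by apply (Series_correct _ Hex).
  apply is_lim_seq_spec in Hlim.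
  destruct (Hlim (mkposreal eps He)) as [N0 HN0]. simpl in HN0.
  exists N0. intros N HN z Hz. specialize (HN0 N HN).
  apply Rabs_def2 in HN0.
  apply Cmod_eps_le. intros e' He'.
  assert (Hz1 : in_disk z) by (unfold in_disk; lra).
  destruct (proj1 (is_pseries_C_eps A z (F z)) (HF z Hz1) e' He') as [N1 HN1].
  set (M := (S N + N1)%nat).
  exists (psum A z M). split; [apply HN1; unfold M; lia|].
  assert (E : forall (G : AbelianGroup) (v : nat -> G), minus (sum_n v M) (sum_n v N) = sum_n_m v (S N) M).
  { intros G v. rewrite sum_n_m_sum_n; [reflexivity|unfold M; lia]. }
  unfold psum.
  change (Cmod (minus (sum_n (fun n => (A n * z ^ n)%C) M)
                   (sum_n (fun n => (A n * z ^ n)%C) N)) <= eps).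
  rewrite (E C_AbelianGroup).
  apply Rle_trans with (sum_n_m u (S N) M).
  - refine (Rle_trans _ _ _ (norm_sum_n_m (K := C_AbsRing) (V := C_NormedModule)
                               (fun n => (A n * z ^ n)%C) (S N) M) _).
    apply sum_n_m_le. intros n.
    change (Cmod (A n * z ^ n)%C <= u n).
    rewrite Cmod_mult, Cmod_pow. unfold u.
    apply Rmult_le_compat_l; [apply Cmod_ge_0|].
    apply pow_incr. split; [apply Cmod_ge_0|exact Hz].
  - rewrite <- (E R_AbelianGroup).
    pose proof (partial_sum_le_Series u M Hu Hex).
    change (sum_n u M - sum_n u N <= eps). lra.
Qed.

(** * Averages over roots of unity *)

Definition expi (t : R) : C := (cos t, sin t).

Lemma expi_plus (s t : R) : expi (s + t) = (expi s * expi t)%C.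
Proof.
  unfold expi, Cmult; simpl. rewrite cos_plus, sin_plus. f_equal; ring.
Qed.

Lemma expi_0 : expi 0 = RtoC 1.
Proof. unfold expi. rewrite cos_0, sin_0. reflexivity. Qed.

Lemma Cmod_expi (t : R) : Cmod (expi t) = 1.
Proof.
  unfold Cmod, expi; simpl.
  replace (_ + _) with 1; [apply sqrt_1|].
  pose proof (sin2_cos2 t) as H. unfold Rsqr in H. lra.
Qed.

Lemma expi_pow (t : R) (n : nat) : (expi t ^ n)%C = expi (INR n * t).
Proof.
  induction n as [|n IH].
  - simpl INR. rewrite Rmult_0_l, expi_0. reflexivity.
  - rewrite Cpow_S, IH, <- expi_plus, S_INR. f_equal. ring.
Qed.

Lemma expi_2PI (d : Z) : expi (IZR d * (2 * PI)) = RtoC 1.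
Proof.
  assert (Hn : forall n : nat, expi (INR n * (2 * PI)) = RtoC 1).
  { intros n. rewrite <- expi_pow.
    replace (expi (2 * PI)) with (RtoC 1); [apply Cpow_1_l|].
    unfold expi. rewrite cos_2PI, sin_2PI. reflexivity. }
  destruct (Z_le_gt_dec 0 d) as [Hd|Hd].
  - rewrite <- (Z2Nat.id d Hd), <- INR_IZR_INZ. apply Hn.
  - specialize (Hn (Z.to_nat (- d))).
    rewrite INR_IZR_INZ, Z2Nat.id in Hn by lia.
    rewrite <- (Cmult_1_r (expi _)), <- Hn at 1.
    rewrite <- expi_plus, opp_IZR.
    replace (_ + _) with 0 by ring. apply expi_0.
Qed.

(** [cos t = 1 - 2 sin^2 (t / 2)], and the sine does not vanish inside [(0, PI)]. *)
Lemma expi_neq_1 (t : R) : 0 < Rabs t < 2 * PI -> expi t <> RtoC 1.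
Proof.
  intros Ht H. injection H as Hc Hs.
  assert (Hp : 0 < sin (Rabs t / 2)) by (apply sin_gt_0; lra).
  assert (Ha : cos (Rabs t) = 1)
    by (unfold Rabs; destruct (Rcase_abs t); [rewrite cos_neg|]; assumption).
  replace (Rabs t) with (2 * (Rabs t / 2)) in Ha by field.
  rewrite cos_2a_sin in Ha. nra.
Qed.

Definition node (L j : nat) : R := 2 * PI * INR j / INR (S L).

(** The mean over the [S L] equally spaced points of the circle, a finite
    substitute for the integral mean. *)
Definition avg (L : nat) (f : R -> C) : C :=
  (sum_n (fun j => f (node L j)) L / RtoC (INR (S L)))%C.

Lemma INR_S_neq_0 (L : nat) : RtoC (INR (S L)) <> RtoC 0.
Proof. intros H. apply RtoC_inj in H. revert H. apply not_0_INR. lia. Qed.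

Lemma avg_const (L : nat) (c : C) : avg L (fun _ => c) = c.
Proof.
  unfold avg.
  replace (sum_n (fun _ : nat => c) L) with (RtoC (INR (S L)) * c)%C.
  - field. apply INR_S_neq_0.
  - generalize L. clear. induction L as [|L IH].
    + rewrite sum_O. simpl INR. ring.
    + rewrite sum_Sn_C, <- IH, S_INR, RtoC_plus. ring.
Qed.

Lemma avg_ext (L : nat) (f g : R -> C) :
  (forall t, f t = g t) -> avg L f = avg L g.
Proof. intros H. unfold avg. f_equal. apply sum_n_ext. intros; apply H. Qed.

Lemma avg_plus (L : nat) (f g : R -> C) :
  avg L (fun t => f t + g t)%C = (avg L f + avg L g)%C.
Proof.
  unfold avg.
  rewrite (sum_n_Cplus (fun j => f (node L j)) (fun j => g (node L j))). field. apply INR_S_neq_0.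
Qed.

Lemma avg_scal (L : nat) (c : C) (f : R -> C) :
  avg L (fun t => c * f t)%C = (c * avg L f)%C.
Proof.
  unfold avg.
  rewrite (sum_n_Cmult_l c (fun j => f (node L j))). field. apply INR_S_neq_0.
Qed.

Lemma avg_sum (L N : nat) (f : nat -> R -> C) :
  avg L (fun t => sum_n (fun n => f n t) N) = sum_n (fun n => avg L (f n)) N.
Proof.
  induction N as [|N IH].
  - rewrite sum_O. apply avg_ext. intros. apply sum_O.
  - rewrite sum_Sn_C, <- IH, <- avg_plus.
    apply avg_ext. intros. apply sum_Sn_C.
Qed.

Lemma avg_bound (L : nat) (f : R -> C) (g : R -> R) :
  (forall t, Cmod (f t) <= g t) ->
  Cmod (avg L f) <= Re (avg L (fun t => RtoC (g t))).
Proof.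
  intros H. unfold avg.
  rewrite Cmod_div by apply INR_S_neq_0.
  assert (HL : 0 < INR (S L)) by (apply lt_0_INR; lia).
  assert (E : sum_n (fun j => RtoC (g (node L j))) L
              = RtoC (sum_n (fun j => g (node L j)) L)).
  { generalize L at 2 4. intros M. induction M as [|M IH].
    - rewrite !sum_O. reflexivity.
    - rewrite !sum_Sn, IH. symmetry. apply RtoC_plus. }
  rewrite E, <- RtoC_div by lra.
  rewrite Cmod_R, Rabs_pos_eq by lra.
  apply Rmult_le_compat_r; [left; apply Rinv_0_lt_compat, HL|].
  apply Rle_trans with (1 := Cmod_sum_n _ _).
  apply sum_n_le_R. intros. apply H.
Qed.

(** Orthogonality of characters: a geometric sum of a nontrivial root of unity.
    The bound on [d] excludes the nonzero multiples of [S L], whose average is 1. *)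
Lemma avg_expi (L : nat) (d : Z) :
  (Z.abs d <= Z.of_nat L)%Z ->
  avg L (fun t => expi (IZR d * t)) = if (d =? 0)%Z then RtoC 1 else RtoC 0.
Proof.
  intros Hd. destruct (Z.eqb_spec d 0) as [->|Hd0].
  { rewrite <- (avg_const L (RtoC 1)). apply avg_ext. intros t.
    rewrite Rmult_0_l. apply expi_0. }
  assert (HL : 0 < INR (S L)) by (apply lt_0_INR; lia).
  set (z := expi (IZR d * (2 * PI / INR (S L)))).
  assert (Hz : z <> RtoC 1).
  { apply expi_neq_1. pose proof PI_RGT_0 as HPI.
    assert (Hq : 0 < 2 * PI / INR (S L)) by (apply Rdiv_lt_0_compat; lra).
    rewrite Rabs_mult, (Rabs_pos_eq (2 * PI / INR (S L))) by lra.
    rewrite <- abs_IZR.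
    assert (Hd1 : 1 <= IZR (Z.abs d)) by (apply IZR_le; lia).
    assert (Hd2 : IZR (Z.abs d) < INR (S L))
      by (rewrite INR_IZR_INZ; apply IZR_lt; lia).
    split; [nra|].
    apply Rlt_le_trans with (INR (S L) * (2 * PI / INR (S L))).
    - apply Rmult_lt_compat_r; assumption.
    - right. field. lra. }
  assert (HzL : (z ^ S L)%C = RtoC 1).
  { unfold z. rewrite expi_pow.
    replace (_ * _) with (IZR d * (2 * PI)) by (field; lra). apply expi_2PI. }
  assert (Hg : forall M, ((z - 1) * sum_n (fun j => (z ^ j)%C) M = z ^ S M - 1)%C).
  { induction M as [|M IH].
    - rewrite sum_O. change ((z - 1) * 1 = z * 1 - 1)%C. ring.
    - rewrite sum_Sn_C, Cmult_plus_distr_l, IH, !Cpow_S. ring. }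
  assert (H0 : sum_n (fun j => (z ^ j)%C) L = RtoC 0).
  { assert (Hcan : forall s : C, ((z - 1) * s = 1 - 1)%C -> s = RtoC 0).
    { intros s Hs. transitivity ((z - 1) * s / (z - 1))%C.
      - field. apply Cminus_eq_contra, Hz.
      - rewrite Hs. field. apply Cminus_eq_contra, Hz. }
    apply Hcan. rewrite Hg, HzL. reflexivity. }
  unfold avg.
  replace (sum_n _ L) with (RtoC 0); [unfold Cdiv; apply Cmult_0_l|].
  rewrite <- H0. apply sum_n_ext. intros j.
  unfold z, node. rewrite expi_pow. f_equal. field. lra.
Qed.

Definition trig (c : nat -> C) (N : nat) (t : R) : C :=
  sum_n (fun n => (c n * expi (INR n * t))%C) N.

Lemma avg_trig (c : nat -> C) (N L : nat) (p : Z) :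
  (Z.of_nat N + Z.abs p <= Z.of_nat L)%Z ->
  avg L (fun t => expi (IZR p * t) * trig c N t)%C =
  sum_n (fun n => if (Z.of_nat n + p =? 0)%Z then c n else RtoC 0) N.
Proof.
  intros HL.
  transitivity (avg L (fun t => sum_n (fun n =>
     (c n * expi (IZR (Z.of_nat n + p) * t))%C) N)).
  - apply avg_ext. intros t. unfold trig.
    rewrite <- sum_n_Cmult_l.
    apply sum_n_ext. intros n.
    rewrite plus_IZR, <- INR_IZR_INZ, Rmult_plus_distr_r, expi_plus. Cring.
  - rewrite avg_sum. apply sum_n_ext_loc. intros n Hn.
    rewrite avg_scal, avg_expi by lia.
    destruct (_ =? _)%Z; Cring.
Qed.

Lemma sum_n_single (c : nat -> C) (m N : nat) :
  (m <= N)%nat ->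
  sum_n (fun n => if (n =? m)%nat then c n else RtoC 0) N = c m.
Proof.
  assert (Hz : forall M, (M < m)%nat ->
     sum_n (fun n => if (n =? m)%nat then c n else RtoC 0) M = RtoC 0).
  { induction M as [|M IH]; intros HM.
    - rewrite sum_O. destruct (Nat.eqb_spec 0 m); [lia|reflexivity].
    - rewrite sum_Sn_C, IH by lia. destruct (Nat.eqb_spec (S M) m); [lia|].
      apply Cplus_0_l. }
  intros Hm. induction Hm as [|N Hm IH].
  - destruct m as [|m].
    + rewrite sum_O. reflexivity.
    + rewrite sum_Sn_C, Hz, Nat.eqb_refl by lia. apply Cplus_0_l.
  - rewrite sum_Sn_C, IH. destruct (Nat.eqb_spec (S N) m); [lia|].
    apply Cplus_0_r.
Qed.

Lemma avg_trig_coeff (c : nat -> C) (N L m : nat) :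
  (m <= N)%nat -> (N + m <= L)%nat ->
  avg L (fun t => expi (IZR (- Z.of_nat m) * t) * trig c N t)%C = c m.
Proof.
  intros Hm HL. rewrite avg_trig by lia.
  rewrite <- (sum_n_single c m N Hm). apply sum_n_ext. intros n.
  destruct (Z.eqb_spec (Z.of_nat n + - Z.of_nat m) 0), (Nat.eqb_spec n m);
    (reflexivity || lia).
Qed.

(** Raising all frequencies by [p >= 0] leaves frequency zero either empty or,
    for [p = 0], with coefficient [c 0]. *)
Lemma avg_trig_high (c : nat -> C) (N L p : nat) :
  c O = RtoC 0 -> (N + p <= L)%nat ->
  avg L (fun t => expi (IZR (Z.of_nat p) * t) * trig c N t)%C = RtoC 0.
Proof.
  intros H0 HL. rewrite avg_trig by lia.
  transitivity (c O); [|exact H0]. rewrite <- (sum_n_single c 0 N) by lia.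
  apply sum_n_ext. intros n.
  destruct (Z.eqb_spec (Z.of_nat n + Z.of_nat p) 0), (Nat.eqb_spec n 0);
    try reflexivity; try lia. subst n. symmetry; exact H0.
Qed.

Lemma trig_coeff_bound (c : nat -> C) (N m : nat) (B : R) :
  (m <= N)%nat -> (forall t, Cmod (trig c N t) <= B) -> Cmod (c m) <= B.
Proof.
  intros Hm HB.
  rewrite <- (avg_trig_coeff c N (N + m) m) by lia.
  apply Rle_trans with (Re (avg (N + m) (fun _ => RtoC B))).
  - apply avg_bound. intros t. rewrite Cmod_mult, Cmod_expi, Rmult_1_l. apply HB.
  - rewrite avg_const. simpl. lra.
Qed.

(** The kernel [e^(-i(k+2)t) (1 + q e^(i(k+1)t))^2] extracts exactly this
    combination of coefficients; its modulus is a squared modulus, whose mean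
    [1 + |q|^2] is explicit. *)
Lemma trig_two_coeff_bound (c : nat -> C) (N k : nat) (q : C) (B : R) :
  c O = RtoC 0 -> (S (S k) <= N)%nat ->
  (forall t, Cmod (trig c N t) <= B) ->
  Cmod (c (S (S k)) + 2 * q * c 1%nat) <= B * (1 + Cmod q ^ 2).
Proof.
  intros H0 HN HB.
  set (L := (N + S (S k))%nat).
  set (E := fun p t => (expi (IZR p * t) * trig c N t)%C).
  set (f := fun t => (E (- Z.of_nat (S (S k)))%Z t
              + (2 * q * E (- Z.of_nat 1)%Z t + q ^ 2 * E (Z.of_nat k) t))%C).
  assert (Hf : avg L f = (c (S (S k)) + 2 * q * c 1%nat)%C).
  { unfold f. rewrite !avg_plus, !avg_scal. unfold E.
    rewrite !avg_trig_coeff, avg_trig_high by (unfold L; lia || assumption).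
    ring. }
  set (h := fun t => (expi (INR (S k) * t))).
  assert (Hfac : forall t, f t = (expi (IZR (- Z.of_nat (S (S k))) * t)
                   * (1 + q * h t) ^ 2 * trig c N t)%C).
  { intros t. unfold f, E.
    (* the frequencies -(k+2), -1 and k are in arithmetic progression, so the
       kernel is a perfect square times its lowest frequency *)
    assert (E1 : expi (IZR (- Z.of_nat 1) * t)
            = (expi (IZR (- Z.of_nat (S (S k))) * t) * h t)%C).
    { unfold h. rewrite <- expi_plus. f_equal.
      rewrite !opp_IZR, <- !INR_IZR_INZ, !S_INR. simpl. ring. }
    assert (E2 : expi (IZR (Z.of_nat k) * t)
            = (expi (IZR (- Z.of_nat (S (S k))) * t) * h t * h t)%C).
    { unfold h. rewrite <- !expi_plus. f_equal.
      rewrite !opp_IZR, <- !INR_IZR_INZ, !S_INR. ring. }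
    rewrite E1, E2. simpl. ring. }
  rewrite <- Hf.
  assert (HB0 : 0 <= B) by (apply Rle_trans with (2 := HB 0); apply Cmod_ge_0).
  apply Rle_trans with (Re (avg L (fun t => RtoC (B * Cmod (1 + q * h t) ^ 2)))).
  - apply avg_bound. intros t. rewrite Hfac, !Cmod_mult, Cmod_pow, Cmod_expi.
    rewrite Rmult_1_l, Rmult_comm. apply Rmult_le_compat_r; [|apply HB].
    apply pow_le, Cmod_ge_0.
  - right.
    assert (Hs : forall t, RtoC (B * Cmod (1 + q * h t) ^ 2) =
       (RtoC (B * (1 + Cmod q ^ 2))
        + (RtoC B * q * expi (IZR (Z.of_nat (S k)) * t)
           + RtoC B * Cconj q * expi (IZR (- Z.of_nat (S k)) * t)))%C).
    { intros t. rewrite opp_IZR, <- INR_IZR_INZ.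
      unfold h. rewrite Ropp_mult_distr_l_reverse. generalize (INR (S k) * t). intros x.
      rewrite RtoC_mult.
      rewrite <- Cconj_mult_self, RtoC_mult, RtoC_plus, <- Cconj_mult_self.
      assert (Hinv : (expi x * expi (- x))%C = RtoC 1).
      { rewrite <- expi_plus. replace (x + - x) with 0 by ring. apply expi_0. }
      replace (Cconj (1 + q * expi x)) with (1 + Cconj q * expi (- x))%C.
      2:{ unfold expi. rewrite cos_neg, sin_neg.
          unfold Cmult, Cplus, Cconj, RtoC; simpl. f_equal; ring. }
      transitivity (B * (1 + q * Cconj q * (expi x * expi (- x)) + q * expi x
                      + Cconj q * expi (- x)))%C; [ring|].
      rewrite Hinv. ring. }
    rewrite (avg_ext _ _ _ Hs), !avg_plus, avg_const, !avg_scal, !avg_expi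
      by (unfold L; lia).
    destruct (Z.eqb_spec (Z.of_nat (S k)) 0); [lia|].
    destruct (Z.eqb_spec (- Z.of_nat (S k)) 0); [lia|].
    rewrite !Cmult_0_r, !Cplus_0_r. reflexivity.
Qed.

(** * Cauchy estimate and uniqueness of coefficients *)

Lemma psum_circle (A : nat -> C) (s t : R) (N : nat) :
  psum A (s * expi t)%C N = trig (fun n => (A n * s ^ n)%C) N t.
Proof.
  apply sum_n_ext. intros n.
  rewrite Cpow_mult_l, expi_pow. Cring.
Qed.

Lemma Cmod_circle (s t : R) : 0 <= s -> Cmod (s * expi t) = s.
Proof. intros Hs. rewrite Cmod_mult, Cmod_expi, Cmod_R, Rabs_pos_eq; lra. Qed.

Lemma trig_eventually_bounded (F : C -> C) (A : nat -> C) (s B eps : R) :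
  has_expansion F A -> 0 <= s < 1 -> 0 < eps ->
  (forall z, in_disk z -> Cmod (F z) <= B) ->
  exists N0, forall N, (N0 <= N)%nat ->
    forall t, Cmod (trig (fun n => (A n * s ^ n)%C) N t) <= B + eps.
Proof.
  intros HF Hs He HB.
  destruct (uniform_tail F A s HF Hs eps He) as [N0 HN0].
  exists N0. intros N HN t. rewrite <- psum_circle.
  set (z := (s * expi t)%C).
  assert (Hz : Cmod z = s) by (apply Cmod_circle; lra).
  replace (psum A z N) with (F z + - (F z - psum A z N))%C by ring.
  apply Rle_trans with (1 := Cmod_triangle _ _). rewrite Cmod_opp.
  apply Rplus_le_compat; [apply HB; unfold in_disk|apply HN0; [exact HN|]]; lra.
Qed.

Lemma Cmod_scaled (x : C) (s : R) (n : nat) :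
  0 <= s -> Cmod (x * s ^ n) = Cmod x * s ^ n.
Proof. intros Hs. rewrite Cmod_mult, Cmod_pow, Cmod_R, Rabs_pos_eq; lra. Qed.

(** Averaging a long truncation against [e^(-imt)] isolates the [m]-th term. *)
Lemma cauchy_estimate (F : C -> C) (A : nat -> C) (s B : R) (m : nat) :
  has_expansion F A -> 0 <= s < 1 ->
  (forall z, in_disk z -> Cmod (F z) <= B) ->
  Cmod (A m) * s ^ m <= B.
Proof.
  intros HF Hs HB. apply le_epsilon. intros eps He.
  destruct (trig_eventually_bounded F A s B eps HF Hs He HB) as [N0 HN0].
  rewrite <- Cmod_scaled by lra.
  apply (trig_coeff_bound (fun n => (A n * s ^ n)%C) (N0 + m) m); [lia|].
  apply HN0. lia.
Qed.

(** The difference of two expansions represents 0, and the Cauchy estimate with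
    [B = 0] makes its coefficients vanish. *)
Lemma coefficients_unique (F : C -> C) (A B : nat -> C) :
  has_expansion F A -> has_expansion F B -> forall n, A n = B n.
Proof.
  intros HA HB n.
  assert (HD : has_expansion (fun _ => RtoC 0) (fun n => (A n - B n)%C)).
  { intros z Hz. apply is_pseries_C_eps. intros eps He.
    assert (He2 : 0 < eps / 2) by lra.
    destruct (proj1 (is_pseries_C_eps A z (F z)) (HA z Hz) _ He2) as [N1 H1].
    destruct (proj1 (is_pseries_C_eps B z (F z)) (HB z Hz) _ He2) as [N2 H2].
    exists (N1 + N2)%nat. intros N HN.
    specialize (H1 N ltac:(lia)). specialize (H2 N ltac:(lia)).
    assert (E : psum (fun n => (A n - B n)%C) z N = (psum A z N - psum B z N)%C).
    { unfold psum. transitivity (sum_n (fun n => (A n * z ^ n)%C + (- 1) * (B n * z ^ n))%C N).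
      - apply sum_n_ext. intros. Cring.
      - rewrite sum_n_Cplus, sum_n_Cmult_l. Cring. }
    rewrite E.
    replace (_ - _ - _)%C with ((psum A z N - F z) + - (psum B z N - F z))%C by ring.
    apply Rle_lt_trans with (1 := Cmod_triangle _ _). rewrite Cmod_opp. lra. }
  assert (H := cauchy_estimate _ _ (1 / 2) 0 n HD ltac:(lra)
                 (fun z _ => Req_le _ _ Cmod_0)).
  simpl in H.
  assert (0 < (1 / 2) ^ n) by (apply pow_lt; lra).
  pose proof (Cmod_ge_0 (A n - B n)).
  apply Ceq_minus, Cmod_eq_0. nra.
Qed.

Lemma coeffs_eq (F : C -> C) (A : nat -> C) :
  has_expansion F A -> forall n, coeffs F n = A n.
Proof.
  intros HA. apply coefficients_unique with F; [|exact HA].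
  unfold coeffs. apply epsilon_spec. exists A. exact HA.
Qed.

Lemma coeff_0 (F : C -> C) (A : nat -> C) : has_expansion F A -> A O = F (RtoC 0).
Proof.
  intros HF. apply Ceq_minus, Cmod_eq_0. apply Rle_antisym; [|apply Cmod_ge_0].
  apply le_epsilon. intros eps He. rewrite Rplus_0_l.
  assert (H0 : in_disk (RtoC 0)) by (unfold in_disk; rewrite Cmod_0; lra).
  destruct (proj1 (is_pseries_C_eps A _ _) (HF _ H0) eps He) as [N HN].
  specialize (HN N (le_n N)).
  replace (psum A (RtoC 0) N) with (A O) in HN; [lra|].
  unfold psum. rewrite <- (sum_n_single A 0 N) by lia.
  apply sum_n_ext. intros [|n]; simpl; ring.
Qed.

(** * Coefficients of bounded functions vanishing at the origin *)

Lemma le_at_1 (f : R -> R) (M : R) :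
  continuous f 1 -> (forall s, 0 < s < 1 -> f s <= M) -> f 1 <= M.
Proof.
  intros Hc H. apply Rnot_lt_le. intros Hlt.
  assert (Hl : locally (f 1) (fun y => M < y)) by (apply open_gt; exact Hlt).
  apply Hc in Hl. destruct Hl as [d Hd].
  set (e := Rmin (d / 2) (1 / 2)).
  assert (He : 0 < e) by (apply Rmin_pos; [apply is_pos_div_2|lra]).
  assert (He1 : e <= d / 2) by apply Rmin_l.
  assert (He2 : e <= 1 / 2) by apply Rmin_r.
  pose proof (cond_pos d).
  assert (Hb : ball 1 d (1 - e)).
  { unfold ball; simpl; unfold AbsRing_ball, abs, minus, plus, opp; simpl.
    apply Rabs_def1; lra. }
  specialize (Hd _ Hb). specialize (H (1 - e) ltac:(lra)). simpl in Hd. lra.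
Qed.

Lemma polar (x : C) : exists u, Cmod u = 1 /\ x = (Cmod x * u)%C.
Proof.
  destruct (Ceq_dec x (RtoC 0)) as [->|Hx].
  - exists (RtoC 1). rewrite Cmod_1, Cmod_0. split; [reflexivity|ring].
  - assert (H0 : 0 < Cmod x) by (apply Cmod_gt_0, Hx).
    assert (H0' : RtoC (Cmod x) <> RtoC 0)
      by (intros H; apply RtoC_inj in H; lra).
    exists (x / Cmod x)%C. split; [|field; exact H0'].
    rewrite Cmod_div, Cmod_R, Rabs_pos_eq by (assumption || lra). field. lra.
Qed.

Lemma Cmod_conj (y : C) : Cmod (Cconj y) = Cmod y.
Proof. unfold Cmod, Cconj; simpl. f_equal. ring. Qed.

(** On the circle of radius [s], choose [q] of modulus [|w_1| s] so that both
    terms of [w_(k+2) s^(k+2) + 2 q w_1 s] have the phase of [w_(k+2)]; the bound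
    [1 + |q|^2] becomes [|w_(k+2)| s^(k+2) + (|w_1| s)^2 <= 1], and [s] tends to 1.
    For [k = 0] the kernel also meets the constant coefficient, which is
    zero. *)
Lemma schwarz_pick_coeff (w : C -> C) (A : nat -> C) (k : nat) :
  has_expansion w A -> w (RtoC 0) = RtoC 0 ->
  (forall z, in_disk z -> in_disk (w z)) ->
  Cmod (A (S (S k))) <= 1 - Cmod (A 1%nat) ^ 2.
Proof.
  intros HA H0 Hw.
  set (x := A (S (S k))). set (y := A 1%nat).
  set (f := fun s : R => Cmod x * s ^ S (S k) + (Cmod y * s) ^ 2).
  enough (Hf : f 1 <= 1).
  { unfold f in Hf. rewrite pow1, !Rmult_1_r in Hf. lra. }
  apply le_at_1.
  { apply (ex_derive_continuous (K := R_AbsRing) (V := R_NormedModule)).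
    unfold f. auto_derive. exact I. }
  intros s Hs.
  destruct (polar x) as [u [Hu Hx]].
  set (q := (Cconj y * s * u)%C).
  assert (Hq : Cmod q = Cmod y * s).
  { unfold q. rewrite !Cmod_mult, Hu, Cmod_conj, Cmod_R, Rabs_pos_eq by lra. ring. }
  set (c := fun n => (A n * s ^ n)%C).
  assert (Hb : Cmod (c (S (S k)) + 2 * q * c 1%nat) <= 1 * (1 + Cmod q ^ 2)).
  { apply le_epsilon. intros eps He.
    (* d is the truncation error that costs eps after the factor 1 + |q|^2 *)
    set (d := eps / (1 + Cmod q ^ 2)).
    assert (Hp : 0 < 1 + Cmod q ^ 2) by (pose proof (pow2_ge_0 (Cmod q)); lra).
    assert (Hd : 0 < d) by (apply Rdiv_lt_0_compat; assumption).
    destruct (trig_eventually_bounded w A s 1 d HA) as [N0 HN0]; [lra|exact Hd| |].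
    { intros z Hz. left. apply Hw, Hz. }
    replace (1 * (1 + Cmod q ^ 2) + eps) with ((1 + d) * (1 + Cmod q ^ 2))
      by (unfold d; field; lra).
    apply trig_two_coeff_bound with (N0 + S (S k))%nat; [|lia|apply HN0; lia].
    unfold c. rewrite (coeff_0 w A HA), H0. ring. }
  assert (E : (c (S (S k)) + 2 * q * c 1%nat)%C
              = (RtoC (Cmod x * s ^ S (S k) + 2 * (Cmod y * s) ^ 2) * u)%C).
  { unfold c, q. fold x y. rewrite Hx at 1.
    transitivity ((Cmod x * s ^ S (S k) + 2 * (Cconj y * y) * s * s) * u)%C.
    - rewrite Cpow_1_r. ring.
    - rewrite Cconj_mult_self.
      rewrite RtoC_plus, !RtoC_mult, !RtoC_pow, RtoC_mult. ring. }
  rewrite E, Cmod_mult, Hu, Cmod_R, Hq in Hb.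
  pose proof (Rle_abs (Cmod x * s ^ S (S k) + 2 * (Cmod y * s) ^ 2)).
  unfold f. lra.
Qed.

(** * Termwise differentiation *)

(** The complex counterpart of [PS_derive]. *)
Definition derived (A : nat -> C) (n : nat) : C := (INR (S n) * A (S n))%C.

Lemma Cmod_derived (A : nat -> C) (n : nat) :
  Cmod (derived A n) = PS_derive (fun n => Cmod (A n)) n.
Proof.
  unfold derived, PS_derive. rewrite Cmod_mult, Cmod_R, Rabs_pos_eq by apply pos_INR.
  reflexivity.
Qed.

(** Induction through the identity
    [R_(n+1) = y R_n + (y - z)^2 n z^(n-1)] for the first-order Taylor remainder
    [R_n] of the [n]-th power. *)
Lemma pow_taylor_bound (y z : C) (s : R) (m : nat) :
  Cmod y <= s -> Cmod z <= s ->
  Cmod (y ^ S (S m) - z ^ S (S m) - (y - z) * (INR (S (S m)) * z ^ S m))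
    <= INR (S m) * (INR (S (S m)) * s ^ m) * Cmod (y - z) ^ 2.
Proof.
  intros Hy Hz.
  assert (Hs : 0 <= s) by (apply Rle_trans with (2 := Hy); apply Cmod_ge_0).
  assert (Hd := pow2_ge_0 (Cmod (y - z))).
  induction m as [|m IH].
  - replace (_ - _)%C with ((y - z) ^ 2)%C
      by (simpl INR; rewrite RtoC_plus; simpl; ring).
    rewrite Cmod_pow. simpl INR. simpl (s ^ 0). lra.
  - set (n := S (S m)) in *.
    replace (_ - _)%C with
      (y * (y ^ n - z ^ n - (y - z) * (INR n * z ^ S m))
       + (y - z) ^ 2 * (INR n * z ^ S m))%C.
    2:{ rewrite (S_INR n), RtoC_plus, (Cpow_S y n), (Cpow_S z n).
        replace (z ^ n)%C with (z * z ^ S m)%C by (symmetry; apply Cpow_S).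
        simpl (_ ^ 2)%C. ring. }
    apply Rle_trans with (1 := Cmod_triangle _ _).
    rewrite !Cmod_mult, !Cmod_pow, Cmod_R, Rabs_pos_eq by apply pos_INR.
    assert (Hzp : Cmod z ^ S m <= s ^ S m)
      by (apply pow_incr; split; [apply Cmod_ge_0|exact Hz]).
    set (T := Cmod (y ^ n - z ^ n - (y - z) * (INR n * z ^ S m))) in *.
    set (D := Cmod (y - z) ^ 2) in *.
    assert (HT : 0 <= T) by apply Cmod_ge_0.
    assert (Hn : 0 <= INR n) by apply pos_INR.
    assert (Hsp : 0 <= s ^ S m) by (apply pow_le; exact Hs).
    assert (H1 : Cmod y * T <= INR (S m) * (INR n * s ^ S m) * D).
    { apply Rle_trans with (s * (INR (S m) * (INR n * s ^ m) * D)).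
      - apply Rmult_le_compat; [apply Cmod_ge_0|exact HT|exact Hy|exact IH].
      - right. simpl (s ^ S m). ring. }
    assert (H2 : D * (INR n * Cmod z ^ S m) <= D * (INR n * s ^ S m))
      by (apply Rmult_le_compat_l, Rmult_le_compat_l; assumption).
    assert (H3 : 0 <= INR n * s ^ S m * D)
      by (apply Rmult_le_pos; [apply Rmult_le_pos|]; assumption).
    rewrite (S_INR n). replace (INR (S m)) with (INR n - 1) in H1
      by (unfold n; rewrite (S_INR (S m)); ring).
    nra.
Qed.

Lemma psum_S (A : nat -> C) (z : C) (N : nat) :
  psum A z (S N) = (psum A z N + A (S N) * z ^ S N)%C.
Proof. apply sum_Sn_C. Qed.

Lemma psum_0 (A : nat -> C) (z : C) : psum A z 0 = A O.
Proof. unfold psum. rewrite sum_O. simpl. Cring. Qed.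

(** The powers 0 and 1 have no remainder, so the sum starts at the second
    power. *)
Lemma psum_taylor (A : nat -> C) (y z : C) (M : nat) :
  (psum A y (S (S M)) - psum A z (S (S M)) - (y - z) * psum (derived A) z (S M))%C
  = sum_n (fun m => A (S (S m)) *
      (y ^ S (S m) - z ^ S (S m) - (y - z) * (INR (S (S m)) * z ^ S m)))%C M.
Proof.
  induction M as [|M IH].
  - rewrite sum_O, !psum_S, !psum_0. unfold derived. simpl. ring.
  - rewrite sum_Sn_C, <- IH, (psum_S A y (S (S M))), (psum_S A z (S (S M))),
      (psum_S (derived A) z (S M)).
    unfold derived at 2. ring.
Qed.

Lemma second_derivative_summable (F : C -> C) (A : nat -> C) (s : R) :
  has_expansion F A -> 0 <= s < 1 ->
  ex_series (fun n => Cmod (derived (derived A) n) * s ^ n).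
Proof.
  intros HF Hs.
  apply ex_series_ext with
    (fun n => Rabs (PS_derive (PS_derive (fun n => Cmod (A n))) n * s ^ n)).
  - intros n. rewrite Cmod_derived. unfold PS_derive at 1 3.
    rewrite Cmod_derived. apply Rabs_pos_eq.
    apply Rmult_le_pos; [|apply pow_le; lra].
    apply Rmult_le_pos; [apply pos_INR|].
    rewrite <- Cmod_derived. apply Cmod_ge_0.
  - apply CV_disk_inside. rewrite !CV_radius_derive, Rabs_pos_eq by lra.
    apply CV_radius_ge_1 with F; assumption.
Qed.

Lemma derived_converges (F : C -> C) (A : nat -> C) (z : C) :
  has_expansion F A -> in_disk z ->
  exists l, is_pseries (K := C_AbsRing) (V := C_NormedModule) (derived A) z l.
Proof.
  intros HF Hz.
  apply (ex_series_le (K := C_AbsRing) (V := C_CompleteNormedModule))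
    with (b := fun n => Rabs (PS_derive (fun n => Cmod (A n)) n * Cmod z ^ n)).
  - intros n. rewrite pow_n_Cpow. rewrite <- Cmod_derived.
    change (Cmod (z ^ n * derived A n) <= Rabs (Cmod (derived A n) * Cmod z ^ n)).
    rewrite Cmod_mult, Cmod_pow, Rmult_comm. apply Rle_abs.
  - apply CV_disk_inside. rewrite CV_radius_derive, Rabs_pos_eq by apply Cmod_ge_0.
    apply CV_radius_ge_1 with F; [exact HF|]. split; [apply Cmod_ge_0|exact Hz].
Qed.

(** Summing the remainders of the powers is dominated by the twice differentiated
    series of moduli at [s], so the constant is uniform on the closed disk of
    radius [s]. *)
Lemma taylor_remainder (F : C -> C) (A : nat -> C) (s : R) :
  has_expansion F A -> 0 <= s < 1 ->
  exists K, forall y z l, Cmod y <= s -> Cmod z <= s ->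
    is_pseries (K := C_AbsRing) (V := C_NormedModule) (derived A) z l ->
    Cmod (F y - F z - (y - z) * l) <= K * Cmod (y - z) ^ 2.
Proof.
  intros HF Hs.
  set (u := fun n => Cmod (derived (derived A) n) * s ^ n).
  assert (Hu : forall n, 0 <= u n)
    by (intros n; apply Rmult_le_pos; [apply Cmod_ge_0|apply pow_le; lra]).
  assert (Hex : ex_series u) by (apply second_derivative_summable with F; assumption).
  exists (Series u). intros y z l Hy Hz Hl.
  set (D := Cmod (y - z)).
  assert (HD : 0 <= D) by apply Cmod_ge_0.
  replace (F y - F z - (y - z) * l)%C
    with (F y - (F z + (y - z) * l))%C by ring.
  apply Cmod_eps_le. intros eps He.
  (* two function values and a slope multiplied by D are approximated within e *)
  set (e := eps / (2 + D)).
  assert (He' : 0 < e) by (apply Rdiv_lt_0_compat; lra).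
  assert (HFy : in_disk y) by (unfold in_disk; lra).
  assert (HFz : in_disk z) by (unfold in_disk; lra).
  destruct (proj1 (is_pseries_C_eps _ _ _) (HF y HFy) e He') as [N1 H1].
  destruct (proj1 (is_pseries_C_eps _ _ _) (HF z HFz) e He') as [N2 H2].
  destruct (proj1 (is_pseries_C_eps _ _ _) Hl e He') as [N3 H3].
  set (M := (N1 + N2 + N3)%nat).
  specialize (H1 (S (S M)) ltac:(unfold M; lia)).
  specialize (H2 (S (S M)) ltac:(unfold M; lia)).
  specialize (H3 (S M) ltac:(unfold M; lia)).
  set (a := (psum A y (S (S M)) - F y)%C) in *.
  set (b := (psum A z (S (S M)) - F z)%C) in *.
  set (c := (psum (derived A) z (S M) - l)%C) in *.
  exists (F y + (a + (- b + - ((y - z) * c))))%C. split.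
  - replace (_ - F y)%C with (a + (- b + - ((y - z) * c)))%C by ring.
    apply Rle_lt_trans with (Cmod a + (Cmod b + D * Cmod c)).
    { apply Rle_trans with (1 := Cmod_triangle _ _). apply Rplus_le_compat_l.
      apply Rle_trans with (1 := Cmod_triangle _ _).
      rewrite !Cmod_opp, Cmod_mult. fold D. lra. }
    apply Rlt_le_trans with ((2 + D) * e).
    + assert (D * Cmod c <= D * e) by (apply Rmult_le_compat_l; lra). lra.
    + right. unfold e. field. lra.
  - replace (_ - _)%C with
      (psum A y (S (S M)) - psum A z (S (S M)) - (y - z) * psum (derived A) z (S M))%C
      by (unfold a, b, c; ring).
    rewrite psum_taylor.
    apply Rle_trans with (1 := Cmod_sum_n _ _).
    apply Rle_trans with (sum_n u M * D ^ 2).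
    + replace (sum_n u M * D ^ 2) with (sum_n (fun m => u m * D ^ 2) M)
        by exact (sum_n_mult_r (K := R_Ring) (D ^ 2) u M).
      apply sum_n_le_R. intros m _.
      rewrite Cmod_mult.
      apply Rle_trans with (Cmod (A (S (S m))) * (INR (S m) * (INR (S (S m)) * s ^ m) * D ^ 2)).
      * apply Rmult_le_compat_l; [apply Cmod_ge_0|].
        apply pow_taylor_bound; assumption.
      * right. unfold u. rewrite Cmod_derived. unfold PS_derive at 1.
        rewrite Cmod_derived. unfold PS_derive.
        ring.
    + apply Rmult_le_compat_r; [apply pow2_ge_0|].
      apply partial_sum_le_Series; assumption.
Qed.

(** A quadratic remainder on a disk slightly larger than [|z|] is a little-o of
    the increment. *)
Lemma expansion_is_derive (F : C -> C) (A : nat -> C) (z l : C) :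
  has_expansion F A -> in_disk z ->
  is_pseries (K := C_AbsRing) (V := C_NormedModule) (derived A) z l ->
  is_derive (K := C_AbsRing) (V := C_NormedModule) F z l.
Proof.
  intros HF Hz Hl. unfold in_disk in Hz.
  set (s := (1 + Cmod z) / 2).
  pose proof (Cmod_ge_0 z) as Hz0.
  destruct (taylor_remainder F A s HF) as [K HK]; [unfold s; lra|].
  split; [apply is_linear_scal_l|].
  intros x Hx.
  assert (Exz : z = x)
    by exact (is_filter_lim_locally_unique (V := AbsRing_NormedModule C_AbsRing) _ _ Hx).
  destruct Exz. clear Hx.
  intros eps. pose proof (cond_pos eps) as He.
  set (d := Rmin (s - Cmod z) (eps / (1 + Rabs K))).
  pose proof (Rabs_pos K) as HK0.
  assert (Hd : 0 < d).
  { apply Rmin_pos; [unfold s; lra|]. apply Rdiv_lt_0_compat; lra. }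
  exists (mkposreal d Hd). intros y Hy.
  change (Cmod (y - z) < d) in Hy.
  change (Cmod (F y - F z - (y - z) * l) <= eps * Cmod (y - z)).
  assert (Hd1 : d <= s - Cmod z) by apply Rmin_l.
  assert (Hd2 : d <= eps / (1 + Rabs K)) by apply Rmin_r.
  assert (Hys : Cmod y <= s).
  { replace y with ((y - z) + z)%C by ring.
    apply Rle_trans with (1 := Cmod_triangle _ _). lra. }
  apply Rle_trans with (1 := HK y z l Hys ltac:(unfold s; lra) Hl).
  pose proof (Cmod_ge_0 (y - z)) as HD.
  replace (K * Cmod (y - z) ^ 2) with (K * Cmod (y - z) * Cmod (y - z)) by ring.
  apply Rmult_le_compat_r; [exact HD|].
  apply Rle_trans with ((1 + Rabs K) * d).
  - pose proof (Rle_abs K). apply Rmult_le_compat_r with (1 := HD) in H. nra.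
  - apply Rle_trans with ((1 + Rabs K) * (eps / (1 + Rabs K))).
    + apply Rmult_le_compat_l; lra.
    + right. field. lra.
Qed.

Lemma derive_expansion (F : C -> C) (A : nat -> C) :
  has_expansion F A -> has_expansion (C_derive F) (derived A).
Proof.
  intros HF z Hz.
  destruct (derived_converges F A z HF Hz) as [l Hl].
  rewrite (is_C_derive_unique F z l); [exact Hl|].
  apply expansion_is_derive with A; assumption.
Qed.

(** * The majorant of the derivative below the critical radius *)

Definition arith_geom (r : R) (N : nat) : R := sum_n (fun n => INR (S n) * r ^ n) N.

(** Multiplying by [(1 - r)^2] telescopes to
    [1 - (N + 2) r^(N+1) + (N + 1) r^(N+2)]. *)
Lemma arith_geom_le (r : R) (N : nat) :
  0 <= r <= 1 -> (1 - r) ^ 2 * arith_geom r N <= 1.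
Proof.
  intros Hr.
  assert (E : (1 - r) ^ 2 * arith_geom r N
              = 1 - (INR N + 2) * r ^ S N + (INR N + 1) * r ^ S (S N)).
  { unfold arith_geom. induction N as [|N IH].
    - rewrite sum_O. simpl. ring.
    - rewrite sum_Sn_R, Rmult_plus_distr_l, IH, !S_INR. simpl. ring. }
  rewrite E. simpl (r ^ S (S N)).
  assert (H : 0 <= r ^ S N) by (apply pow_le; lra). simpl in H.
  pose proof (pos_INR N).
  assert (0 <= (INR N + 1) * (1 - r)) by (apply Rmult_le_pos; lra).
  simpl. nra.
Qed.

(** The Cauchy square of the geometric series. *)
Lemma arith_geom_series (r : R) :
  0 <= r < 1 -> is_series (fun n => INR (S n) * r ^ n) (/ (1 - r) * / (1 - r)).
Proof.
  intros Hr.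
  assert (Hg : is_series (fun n => r ^ n) (/ (1 - r)))
    by (apply is_series_geom; rewrite Rabs_pos_eq; lra).
  assert (Hp : forall n, 0 <= r ^ n) by (intros; apply pow_le; lra).
  apply is_series_ext with (2 := is_series_mult_pos _ _ _ _ Hg Hg Hp Hp).
  intros n. transitivity (sum_f_R0 (fun _ => r ^ n) n).
  - apply sum_eq. intros k Hk. rewrite <- pow_add. f_equal. lia.
  - rewrite <- sum_n_Reals, sum_n_const. reflexivity.
Qed.

Lemma r0_le (r : R) : 0 <= r <= r0 -> r < 1 /\ 2 / 3 <= (1 - r) ^ 2.
Proof.
  unfold r0. intros Hr.
  assert (H : 0 < sqrt (2 / 3)) by (apply sqrt_lt_R0; lra).
  assert (H2 : sqrt (2 / 3) * sqrt (2 / 3) = 2 / 3) by (apply sqrt_sqrt; lra).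
  split; nra.
Qed.

Lemma r0_gt (r : R) : r0 < r < 1 -> (1 - r) ^ 2 < 2 / 3 /\ 0 < r.
Proof.
  unfold r0. intros Hr.
  assert (H : 0 < sqrt (2 / 3)) by (apply sqrt_lt_R0; lra).
  assert (H2 : sqrt (2 / 3) * sqrt (2 / 3) = 2 / 3) by (apply sqrt_sqrt; lra).
  split; nra.
Qed.

Lemma majorant_le (F : C -> C) (A : nat -> C) (r M : R) :
  has_expansion F A ->
  (forall N, sum_n (fun n => Cmod (A n) * r ^ n) N <= M) ->
  Rbar_le (majorant F r) M.
Proof.
  intros HF H. unfold majorant. rewrite <- (Lim_seq_const M).
  apply Lim_seq_le_loc. exists O. intros N _.
  apply Rle_trans with (2 := H N). right. apply sum_n_ext. intros n.
  rewrite (coeffs_eq F A HF). reflexivity.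
Qed.

Lemma majorant_ge (F : C -> C) (A : nat -> C) (r : R) (N : nat) :
  has_expansion F A -> 0 <= r ->
  Rbar_le (sum_n (fun n => Cmod (A n) * r ^ n) N) (majorant F r).
Proof.
  intros HF Hr. unfold majorant.
  rewrite <- (Lim_seq_const (sum_n (fun n => Cmod (A n) * r ^ n) N)).
  apply Lim_seq_le_loc. exists N. intros M HM.
  apply Rle_trans with (sum_n (fun n => Cmod (A n) * r ^ n) M).
  - induction HM as [|M HM IH]; [lra|]. rewrite sum_Sn_R.
    pose proof (Rmult_le_pos _ _ (Cmod_ge_0 (A (S M))) (pow_le r (S M) Hr)). lra.
  - right. apply sum_n_ext. intros n. rewrite (coeffs_eq F A HF). reflexivity.
Qed.

Lemma derived_partial_sum_le (w : C -> C) (A : nat -> C) (r : R) (N : nat) :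
  has_expansion w A -> w (RtoC 0) = RtoC 0 ->
  (forall z, in_disk z -> in_disk (w z)) -> 0 <= r ->
  sum_n (fun n => Cmod (derived A n) * r ^ n) N
    <= Cmod (A 1%nat) + (1 - Cmod (A 1%nat) ^ 2) * (arith_geom r N - 1).
Proof.
  intros HA H0 Hw Hr. unfold arith_geom.
  assert (E : forall n, Cmod (derived A n) = INR (S n) * Cmod (A (S n)))
    by exact (Cmod_derived A).
  induction N as [|N IH].
  - rewrite !sum_O, E. simpl. lra.
  - rewrite !sum_Sn_R, E.
    pose proof (schwarz_pick_coeff w A N HA H0 Hw) as HN.
    assert (Hc : 0 <= INR (S (S N)) * r ^ S N)
      by (apply Rmult_le_pos; [apply pos_INR|apply pow_le, Hr]).
    pose proof (Rmult_le_compat_l _ _ _ Hc HN). lra.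
Qed.

(** With [T - 1 <= 1/2] the bound [a + (1 - a^2) (T - 1)] is at most
    [1 - (1 - a)^2 / 2]. *)
Lemma majorant_derive_le_1 (w : C -> C) (r : R) :
  analytic_self_map w -> w (RtoC 0) = RtoC 0 -> 0 <= r <= r0 ->
  Rbar_le (majorant (C_derive w) r) 1.
Proof.
  intros [[A HA] Hw] H0 Hr.
  destruct (r0_le r Hr) as [Hr1 Hr2].
  apply majorant_le with (1 := derive_expansion w A HA).
  intros N.
  apply Rle_trans with (1 := derived_partial_sum_le w A r N HA H0 Hw (proj1 Hr)).
  set (a := Cmod (A 1%nat)).
  assert (Ha : 0 <= 1 - a ^ 2).
  { apply Rle_trans with (2 := schwarz_pick_coeff w A 0 HA H0 Hw). apply Cmod_ge_0. }
  assert (HT : arith_geom r N <= 3 / 2).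
  { pose proof (arith_geom_le r N ltac:(lra)) as HT.
    set (T := arith_geom r N) in *.
    destruct (Rle_dec T 0); nra. }
  pose proof (pow2_ge_0 (1 - a)). nra.
Qed.

(** * Sharpness *)

(** A Blaschke factor times [z]: all the inequalities [|w_n| <= 1 - a^2] are
    nearly attained at once when [a] is close to 1. *)
Definition blaschke (a : R) (z : C) : C := (z * (a - z) / (1 - a * z))%C.

Definition blaschke_coeff (a : R) (n : nat) : C :=
  match n with
  | O => 0
  | S O => a
  | S (S m) => - (1 - a ^ 2) * a ^ m
  end%R.

Lemma Cmod_sqr (z : C) : Cmod z ^ 2 = fst z ^ 2 + snd z ^ 2.
Proof. unfold Cmod. apply pow2_sqrt. nra. Qed.

Lemma blaschke_den_neq_0 (a : R) (z : C) :
  0 < a < 1 -> in_disk z -> (1 - a * z)%C <> RtoC 0.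
Proof.
  intros Ha Hz H. unfold in_disk in Hz.
  assert (E : Cmod (a * z)%C = 1).
  { replace (a * z)%C with (1 - (1 - a * z))%C by ring. rewrite H.
    replace (1 - 0)%C with (RtoC 1) by ring. apply Cmod_1. }
  rewrite Cmod_mult, Cmod_R, Rabs_pos_eq in E by lra.
  pose proof (Cmod_ge_0 z). nra.
Qed.

(** [|1 - a z|^2 - |a - z|^2 = (1 - a^2) (1 - |z|^2) >= 0]. *)
Lemma blaschke_self_map (a : R) (z : C) :
  0 < a < 1 -> in_disk z -> in_disk (blaschke a z).
Proof.
  intros Ha Hz. pose proof (blaschke_den_neq_0 a z Ha Hz) as Hd.
  unfold in_disk in *. unfold blaschke. rewrite Cmod_div, Cmod_mult by exact Hd.
  assert (Hd0 : 0 < Cmod (1 - a * z)) by (apply Cmod_gt_0, Hd).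
  assert (Hle : Cmod (a - z) <= Cmod (1 - a * z)).
  { assert (Hq : Cmod z ^ 2 <= 1) by (pose proof (Cmod_ge_0 z); nra).
    rewrite Cmod_sqr in Hq. destruct z as [x y]. simpl in Hq.
    unfold Cmod. apply sqrt_le_1_alt. simpl.
    assert (0 <= (1 - a * a) * (1 - (x * x + y * y))) by (apply Rmult_le_pos; nra).
    nra. }
  pose proof (Cmod_ge_0 z). pose proof (Cmod_ge_0 (a - z)).
  apply Rmult_lt_reg_r with (Cmod (1 - a * z)); [exact Hd0|].
  unfold Rdiv. rewrite Rmult_assoc, Rinv_l by lra. nra.
Qed.

(** The coefficients from degree 2 on are geometric, so the remainder has a
    closed form. *)
Lemma blaschke_partial_sum (a : R) (z : C) (M : nat) :
  (1 - a * z)%C <> RtoC 0 ->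
  (psum (blaschke_coeff a) z (S M) - blaschke a z)%C
    = ((1 - a ^ 2) * z ^ 2 * (a * z) ^ M / (1 - a * z))%C.
Proof.
  intros Hd. induction M as [|M IH].
  - rewrite psum_S, psum_0. unfold blaschke; simpl. field. exact Hd.
  - rewrite psum_S.
    transitivity (psum (blaschke_coeff a) z (S M) - blaschke a z
                  + blaschke_coeff a (S (S M)) * z ^ S (S M))%C; [ring|].
    rewrite IH. unfold blaschke_coeff.
    rewrite RtoC_mult, RtoC_opp, RtoC_minus, !RtoC_pow, !Cpow_mult_l, !Cpow_S.
    simpl. field. exact Hd.
Qed.

Lemma blaschke_expansion (a : R) :
  0 < a < 1 -> has_expansion (blaschke a) (blaschke_coeff a).
Proof.
  intros Ha z Hz. apply is_pseries_C_eps. intros eps He.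
  pose proof (blaschke_den_neq_0 a z Ha Hz) as Hd.
  set (D := Cmod (1 - a * z)).
  assert (HD : 0 < D) by (apply Cmod_gt_0, Hd).
  assert (HeD : 0 < eps * D) by (apply Rmult_lt_0_compat; assumption).
  assert (Hgeom : is_lim_seq (fun n => a ^ n) 0)
    by (apply is_lim_seq_geom; rewrite Rabs_pos_eq; lra).
  apply is_lim_seq_spec in Hgeom.
  destruct (Hgeom (mkposreal _ HeD)) as [N0 HN0]. simpl in HN0.
  exists (S N0). intros [|M] HM; [lia|].
  specialize (HN0 M ltac:(lia)). apply Rabs_def2 in HN0.
  rewrite blaschke_partial_sum by exact Hd.
  rewrite Cmod_div by exact Hd. fold D.
  apply Rmult_lt_reg_r with D; [exact HD|].
  unfold Rdiv. rewrite Rmult_assoc, Rinv_l, Rmult_1_r by lra.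
  apply Rle_lt_trans with (1 * a ^ M); [|lra].
  rewrite !Cmod_mult, !Cmod_pow, Cmod_mult, Cmod_R, (Rabs_pos_eq a) by lra.
  rewrite Rpow_mult_distr, <- RtoC_pow, <- RtoC_minus, Cmod_R.
  rewrite Rabs_pos_eq by nra.
  unfold in_disk in Hz. pose proof (Cmod_ge_0 z) as Hz0.
  assert (HaM : 0 <= a ^ M) by (apply pow_le; lra).
  assert (H1 : Cmod z ^ 2 * Cmod z ^ M <= 1).
  { rewrite <- pow_add. rewrite <- (pow1 (2 + M)). apply pow_incr. lra. }
  assert (H2 : 0 <= Cmod z ^ 2 * Cmod z ^ M) by (rewrite <- pow_add; apply pow_le, Hz0).
  replace ((1 - a ^ 2) * Cmod z ^ 2 * (a ^ M * Cmod z ^ M))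
    with ((1 - a ^ 2) * (Cmod z ^ 2 * Cmod z ^ M) * a ^ M) by ring.
  apply Rmult_le_compat_r; [exact HaM|]. nra.
Qed.

(** The powers [a^n] with [n <= N] are all bounded below by [a^N], which is still
    close to 1 when [a] is, [N] being fixed. *)
Lemma blaschke_derived_partial_sum (a r : R) (N M : nat) :
  0 < a < 1 -> 0 <= r -> (M <= N)%nat ->
  a + (1 - a ^ 2) * a ^ N * (arith_geom r M - 1)
    <= sum_n (fun n => Cmod (derived (blaschke_coeff a) n) * r ^ n) M.
Proof.
  intros Ha Hr. unfold arith_geom.
  assert (E : forall n, Cmod (derived (blaschke_coeff a) n)
                        = INR (S n) * Cmod (blaschke_coeff a (S n)))
    by exact (Cmod_derived (blaschke_coeff a)).
  induction M as [|M IH]; intros HM.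
  - rewrite !sum_O, E. simpl. rewrite Cmod_R, Rabs_pos_eq; lra.
  - specialize (IH ltac:(lia)). rewrite !sum_Sn_R, E.
    assert (Hc : 0 <= INR (S (S M)) * r ^ S M)
      by (apply Rmult_le_pos; [apply pos_INR|apply pow_le, Hr]).
    assert (Ha2 : 0 <= 1 - a ^ 2) by nra.
    assert (Hm : (1 - a ^ 2) * a ^ N <= Cmod (blaschke_coeff a (S (S M)))).
    { simpl blaschke_coeff. rewrite Cmod_R, Rabs_left1.
      2:{ pose proof (Rmult_le_pos _ _ Ha2 (pow_le a M ltac:(lra))). lra. }
      assert (HNM : a ^ N <= a ^ M).
      { replace N with (M + (N - M))%nat by lia. rewrite pow_add.
        rewrite <- (Rmult_1_r (a ^ M)) at 2.
        apply Rmult_le_compat_l; [apply pow_le; lra|].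
        rewrite <- (pow1 (N - M)). apply pow_incr. lra. }
      pose proof (Rmult_le_compat_l _ _ _ Ha2 HNM). lra. }
    pose proof (Rmult_le_compat_l _ _ _ Hc Hm). lra.
Qed.

(** If no [a < 1] satisfied [(1 + a) a^N (T - 1) > 1], continuity would give
    [2 (T - 1) <= 1] at [a = 1], against the choice of [N]. *)
Lemma extremal_parameter (r : R) :
  r0 < r < 1 ->
  exists (a : R) (N : nat),
    0 < a < 1 /\ 1 < a + (1 - a ^ 2) * a ^ N * (arith_geom r N - 1).
Proof.
  intros Hr. destruct (r0_gt r Hr) as [Hr2 Hr0].
  assert (HN : exists N, 3 / 2 < arith_geom r N).
  { pose proof (arith_geom_series r ltac:(lra)) as Hs.
    assert (Hl : locally (/ (1 - r) * / (1 - r)) (fun y => 3 / 2 < y)).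
    { apply open_gt. rewrite <- Rinv_mult.
      replace (3 / 2) with (/ (2 / 3)) by field.
      apply Rinv_lt_contravar; [|lra].
      apply Rmult_lt_0_compat; [apply Rmult_lt_0_compat|]; lra. }
    destruct (Hs _ Hl) as [N HN]. exists N. apply HN. lia. }
  destruct HN as [N HN].
  set (T := arith_geom r N) in *.
  destruct (classic (exists a, 0 < a < 1 /\ 1 < (1 + a) * a ^ N * (T - 1)))
    as [[a [Ha H]]|Hno].
  - exists a, N. split; [exact Ha|]. fold T.
    replace ((1 - a ^ 2) * a ^ N * (T - 1)) with ((1 - a) * ((1 + a) * a ^ N * (T - 1))) by ring.
    nra.
  - exfalso.
    assert (H1 : (1 + 1) * 1 ^ N * (T - 1) <= 1).
    { apply (le_at_1 (fun a => (1 + a) * a ^ N * (T - 1))).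
      - apply (ex_derive_continuous (K := R_AbsRing) (V := R_NormedModule)).
        auto_derive. exact I.
      - intros a Ha. apply Rnot_lt_le. intros H. apply Hno. exists a. split; assumption. }
    rewrite pow1 in H1. lra.
Qed.

Theorem theorem1 :
  (forall w : C -> C, analytic_self_map w -> w (RtoC 0) = RtoC 0 ->
     forall r : R, 0 <= r <= r0 ->
       Rbar_le (majorant (C_derive w) r) (Finite 1)) /\
  (forall r : R, r0 < r < 1 ->
     exists w : C -> C, analytic_self_map w /\ w (RtoC 0) = RtoC 0 /\
       Rbar_lt (Finite 1) (majorant (C_derive w) r)).
Proof.
  split.
  - intros w Hw H0 r Hr. apply majorant_derive_le_1; assumption.
  - intros r Hr.
    destruct (extremal_parameter r Hr) as [a [N [Ha HN]]].
    destruct (r0_gt r Hr) as [_ Hr0].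
    exists (blaschke a). repeat split.
    + exists (blaschke_coeff a). apply blaschke_expansion, Ha.
    + intros z. apply blaschke_self_map, Ha.
    + unfold blaschke, Cdiv. ring.
    + apply Rbar_lt_le_trans with
        (sum_n (fun n => Cmod (derived (blaschke_coeff a) n) * r ^ n) N).
      * apply Rlt_le_trans with (1 := HN).
        apply blaschke_derived_partial_sum; [exact Ha|lra|lia].
      * apply majorant_ge; [|lra].
        apply derive_expansion, blaschke_expansion, Ha.
Qed.
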